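(* Let $1\le r<\infty$ and let $\mathcal A$ be a (real- or complex-valued) function on $\mathbb J_0=[1,2]\times[2^{-3},2^{-2}]$. For any $(t,s)\in\mathbb J_0$, $$[\mathcal A(t,\cdot)]_{r,1}\le[\mathcal A]_{r,2}\qquad\text{and}\qquad[\mathcal A(\cdot,s)]_{r,1}\le[\mathcal A]_{r,2}.$$
   Context: One-parameter variation: for a function $a$ on an interval $I$, $[a]_{r,1}=\sup_{L\in\mathbb N}\sup_{t_1<\cdots<t_L,\ t_j\in I}\big(\sum_{j=1}^{L-1}|a(t_{j+1})-a(t_j)|^r\big)^{1/r}$. Here $\mathcal A(t,\cdot)$ is regarded as a function on $[2^{-3},2^{-2}]$ and $\mathcal A(\cdot,s)$ as a function on $[1,2]$. Rectangular variation: for a rectangle $Q=[t_1,t_2]\times[s_1,s_2]\subset\mathbb J_0$, $\mathcal A(Q)=\mathcal A(t_2,s_2)-\mathcal A(t_1,s_2)+\mathcal A(t_1,s_1)-\mathcal A(t_2,s_1)$, and $\{\mathcal A\}_{r,2}=\sup\big(\sum_{j,k}|\mathcal A(I_j\times J_k)|^r\big)^{1/r}$, the supremum being over all finite partitions of $[1,2]$ into intervals $\{I_j\}$ and of $[2^{-3},2^{-2}]$ into intervals $\{J_k\}$ (closed intervals with disjoint interiors). Two-parameter variation norm: $[\mathcal A]_{r,2}=\{\mathcal A\}_{r,2}+[\mathcal A(1,\cdot)]_{r,1}+[\mathcal A(\cdot,2^{-3})]_{r,1}+|\mathcal A(1,2^{-3})|$ (possibly $+\infty$). *)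

(* Defs.v *)
From HB Require Import structures.
From mathcomp Require Import all_boot all_order all_algebra.
From mathcomp Require Import complex.
From mathcomp Require Import all_classical all_reals all_analysis.

Set Implicit Arguments.
Unset Strict Implicit.
Unset Printing Implicit Defensive.
Import Order.TTheory GRing.Theory Num.Theory.
Local Open Scope classical_set_scope.
Local Open Scope ring_scope.

(* Values lie in a normed abelian group V with norm in R, which covers both
   V = R and V = Rcomplex R, the complex numbers with the real-valued modulus.
   A function on [1,2] x [2^-3,2^-2] is given by a total function R -> R -> V;
   only its values on the rectangle enter into the quantities below. *)
Section Variations.
Context {R : realType} {V : normedZmodType R}.

Definition variation1 (r : R) (I : set R) (a : R -> V) : \bar R :=
  ereal_sup [set ((\sum_(j < (size t).-1) `|a t`_j.+1 - a t`_j| `^ r) `^ r^-1)%:E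
            | t in [set t : seq R | sorted <%R t /\ forall x, x \in t -> I x]].

Definition rect_diff (A : R -> R -> V) (t1 t2 s1 s2 : R) : V :=
  A t2 s2 - A t1 s2 + A t1 s1 - A t2 s1.

(* A partition of [a,b] into closed intervals with disjoint interiors is given
   by the points a = p_0 < p_1 < ... < p_n = b, where p = a :: u and u satisfies
   itv_partition a b u; the j-th interval is [p_j, p_(j+1)]. *)
Definition rect_variation (r t0 t1 s0 s1 : R) (A : R -> R -> V) : \bar R :=
  ereal_sup [set x : \bar R | exists u v : seq R,
    [/\ itv_partition t0 t1 u, itv_partition s0 s1 v
      & let t := t0 :: u in let s := s0 :: v in
        x = ((\sum_(j < size u) \sum_(k < size v)
                `|rect_diff A t`_j t`_j.+1 s`_k s`_k.+1| `^ r) `^ r^-1)%:E]].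

Definition variation2 (r t0 t1 s0 s1 : R) (A : R -> R -> V) : \bar R :=
  (rect_variation r t0 t1 s0 s1 A
   + variation1 r `[s0, s1] (fun s => A t0 s)
   + variation1 r `[t0, t1] (fun t => A t s0)
   + `|A t0 s0|%:E)%E.

End Variations.

(* Main.v *)
Require Import Defs.
From mathcomp Require Import all_boot all_order all_algebra.
From mathcomp Require Import complex.
From mathcomp Require Import all_classical all_reals all_analysis.
From mathcomp Require Import ring.
Import Order.TTheory GRing.Theory Num.Theory.
Local Open Scope classical_set_scope.
Local Open Scope ring_scope.

(** For points [p_j] in [[s0, s1]],
    [A t p_(j+1) - A t p_j = (A t0 p_(j+1) - A t0 p_j) + A([t0,t] x [p_j,p_(j+1)])],
    so by Minkowski's inequality the variation sum of [A t] is at most that of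
    [A t0] plus the l^r norm of rectangular differences over one row of cells.
    Subdividing [[t0, t1]] at [t] and adding the missing endpoints to [p]
    yields a grid containing that row. The other inequality follows by
    exchanging the two variables. *)

Lemma minkowski_powR_sum {R : realType} {I : finType} (r : R) (f g : I -> R) :
  1 <= r -> (forall i, 0 <= f i) -> (forall i, 0 <= g i) ->
  (\sum_i (f i + g i) `^ r) `^ r^-1 <=
  (\sum_i f i `^ r) `^ r^-1 + (\sum_i g i `^ r) `^ r^-1.
Proof.
move=> r1 f0 g0; have r0 : 0 < r by exact: lt_le_trans r1.
have rV0 : 0 <= r^-1 by rewrite invr_ge0 ltW.
have root_zero (h : I -> R) :
    (forall i, 0 <= h i) -> (\sum_i h i `^ r) `^ r^-1 = 0 ->
    forall i, h i = 0.
  move=> h0 /eqP; rewrite powR_eq0 => /andP[/eqP S0 _] i.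
  have /(_ i isT) /eqP := psumr_eq0P (fun i _ => powR_ge0 (h i) r) S0.
  by rewrite powR_eq0 => /andP[/eqP].
have sumE (h : I -> R) : \sum_i h i `^ r = ((\sum_i h i `^ r) `^ r^-1) `^ r.
  rewrite -powRrM mulVf ?gt_eqF// powRr1//.
  by apply: sumr_ge0 => i _; exact: powR_ge0.
have Ef := sumE f; have Eg := sumE g.
set a := (\sum_i f i `^ r) `^ r^-1 in Ef *.
set b := (\sum_i g i `^ r) `^ r^-1 in Eg *.
(* The normalisation divides by [a] and [b]; if one of them is zero, the corresponding function
   vanishes and both sides agree. *)
have [a0|a_neq0] := eqVneq a 0.
  rewrite a0 add0r le_eqVlt; apply/orP; left; apply/eqP.
  by congr (_ `^ _); apply: eq_bigr => i _; rewrite (root_zero f)// add0r.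
have [b0|b_neq0] := eqVneq b 0.
  rewrite b0 addr0 le_eqVlt; apply/orP; left; apply/eqP.
  by congr (_ `^ _); apply: eq_bigr => i _; rewrite (root_zero g)// addr0.
have a_gt0 : 0 < a by rewrite lt_neqAle eq_sym a_neq0 powR_ge0.
have b_gt0 : 0 < b by rewrite lt_neqAle eq_sym b_neq0 powR_ge0.
clearbody a b.
have ab_gt0 : 0 < a + b by rewrite addr_gt0.
pose w := a / (a + b).
have w0 : 0 <= w by rewrite divr_ge0// ltW.
have w1 : w <= 1 by rewrite ler_pdivrMr// mul1r lerDl ltW.
have wC : 1 - w = b / (a + b) by rewrite /w; field; rewrite gt_eqF.
(* [(f + g) / (a + b)] is the convex combination of [f / a] and [g / b] with
   weights proportional to [a] and [b]. *)
have cell i : (f i + g i) `^ r <=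
    (a + b) `^ r * (w * (f i `^ r / a `^ r) + (1 - w) * (g i `^ r / b `^ r)).
  have divE x c : 0 <= x -> 0 < c -> (x / c : R) `^ r = x `^ r / c `^ r.
    move=> x0 c0; rewrite powRM ?invr_ge0 ?(ltW c0)//; congr (_ * _).
    apply: (mulfI (x := c `^ r)); first by rewrite gt_eqF ?powR_gt0.
    rewrite mulfV; last by rewrite gt_eqF ?powR_gt0.
    by rewrite -powRM ?invr_ge0 ?(ltW c0)// mulfV ?gt_eqF// powR1.
  rewrite -!divE//.
  have -> : f i + g i = (a + b) * (w * (f i / a) + (1 - w) * (g i / b)).
    by rewrite wC /w; field; rewrite !gt_eqF.
  rewrite powRM ?(ltW ab_gt0)//; last first.
    by rewrite addr_ge0// mulr_ge0 ?subr_ge0// divr_ge0// ltW.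
  rewrite ler_wpM2l ?powR_ge0//.
  have := convex_powR r1 (Itv01 w0 w1) (x := f i / a) (y := g i / b).
  by rewrite !convRE /=; apply; rewrite inE/= in_itv/= andbT divr_ge0// ltW.
(* After normalisation both r-th power sums equal 1, so the weights [w] and [1 - w] add up to 1. *)
have le_pow : \sum_i (f i + g i) `^ r <= (a + b) `^ r.
  apply: (le_trans (ler_sum _ (fun i _ => cell i))).
  rewrite -mulr_sumr big_split/= -!mulr_sumr -!mulr_suml Ef Eg.
  by rewrite !divff ?gt_eqF ?powR_gt0// !mulr1 addrC subrK mulr1.
have -> : a + b = ((a + b) `^ r) `^ r^-1.
  by rewrite -powRrM mulfV ?gt_eqF// powRr1// ltW.
apply: ge0_ler_powR => //; rewrite nnegrE ?powR_ge0//.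
by apply: sumr_ge0 => i _; exact: powR_ge0.
Qed.

Definition consecutive_sum {R : realType} (f : R -> R -> R) (p : seq R) : R :=
  \sum_(j < (size p).-1) f p`_j p`_j.+1.

Lemma consecutive_sum_cons {R : realType} (f : R -> R -> R) x y p :
  consecutive_sum f [:: x, y & p] = f x y + consecutive_sum f (y :: p).
Proof. by rewrite /consecutive_sum /= big_ord_recl. Qed.

Lemma consecutive_sum_ge0 {R : realType} (f : R -> R -> R) p :
  (forall x y, 0 <= f x y) -> 0 <= consecutive_sum f p.
Proof. by move=> f0; apply: sumr_ge0. Qed.

(** Neighbours in [p] remain neighbours in [q], so [q] only contributes further nonnegative terms. A
    mere subsequence would not do: for general [f], inserting a point between two others may
    decrease the sum. *)
Lemma consecutive_sum_infix {R : realType} (f : R -> R -> R) p q :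
  (forall x y, 0 <= f x y) -> infix p q ->
  consecutive_sum f p <= consecutive_sum f q.
Proof.
move=> f0 /infixP[p1 [p2 ->]]; elim: p1 => [|x p1 IH] /=.
  elim: p => [|x p IH] /=.
    by rewrite {1}/consecutive_sum big_ord0 consecutive_sum_ge0.
  case: p IH => [|y p] IH; last by rewrite !consecutive_sum_cons lerD2l.
  by rewrite {1}/consecutive_sum big_ord0 consecutive_sum_ge0.
apply: (le_trans IH); case: (p1 ++ _) => [|y s].
  by rewrite {1}/consecutive_sum big_ord0 consecutive_sum_ge0.
by rewrite consecutive_sum_cons lerDr.
Qed.

(** Endpoints are added only outside [p], never between its points, so that sums over [p] can be
    compared by [consecutive_sum_infix]. *)
Lemma infix_itv_partition {R : realType} (a b : R) p :
  a < b -> sorted <%R p -> (forall x, x \in p -> `[a, b]%classic x) ->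
  exists2 v, itv_partition a b v & infix p (a :: v).
Proof.
move=> ab; case: p => [|x p] xp pab.
  by exists [:: b]; rewrite ?infix0s//; split; rewrite /= ?ab ?eqxx.
rewrite /= in xp.
have /andP[ax _] : a <= x <= b by have := pab x (mem_head _ _); rewrite /= in_itv.
have /andP[_ lb] : a <= last x p <= b.
  by have := pab _ (mem_last x p); rewrite /= in_itv.
(* Partitions are strictly increasing, so [b] is appended only if [p] does not already end there;
   likewise for [a] below. *)
pose post := if last x p < b then [:: b] else [::].
have xpost : itv_partition x b (p ++ post).
  rewrite /post; split; rewrite ?cat_path ?last_cat ?xp/=; case: ltP => //=.
    by move=> ->.
  by move=> bl; rewrite eq_le lb bl.
have [ax'|xa] := ltP a x.
  exists (x :: p ++ post).
    by case: xpost => *; split; rewrite //= ax'.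
  by apply/infixP; exists [:: a], post.
have {}xa : x = a by apply/eqP; rewrite eq_le xa ax.
exists (p ++ post); first by rewrite -xa.
by apply/infixP; exists [::], post; rewrite xa.
Qed.

Section Slices.
Context {R : realType} {V : normedZmodType R}.
Implicit Types (A : R -> R -> V) (r t s : R) (p : seq R).

Lemma variation1_ge0 r (I : set R) (a : R -> V) :
  (0 <= variation1 r I a)%E.
Proof.
(* This is the value at the empty list; it is 0 unless [r = 0], where it is 1. *)
apply: (@le_trans _ _ (((0 : R) `^ r^-1)%:E)); first by rewrite lee_fin powR_ge0.
by apply: ereal_sup_ubound; exists [::] => //=; rewrite big_ord0.
Qed.

Lemma rect_variation_ge0 r t0 t1 s0 s1 A :
  t0 < t1 -> s0 < s1 -> (0 <= rect_variation r t0 t1 s0 s1 A)%E.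
Proof.
move=> t01 s01; rewrite /rect_variation; set S : set (\bar R) := (X in ereal_sup X).
suff [x Sx x0] : exists2 x, S x & (0 <= x)%E.
  by apply: (le_trans x0); exact: ereal_sup_ubound.
eexists; first by exists [:: t1], [:: s1]; split => //; split; rewrite /= ?t01 ?s01 ?eqxx.
by rewrite lee_fin powR_ge0.
Qed.

Lemma row_le_rect_variation r t0 t1 s0 s1 A t p :
  1 <= r -> t0 < t1 -> s0 < s1 -> t0 <= t <= t1 ->
  sorted <%R p -> (forall x, x \in p -> `[s0, s1]%classic x) ->
  ((consecutive_sum (fun x y => `|rect_diff A t0 t x y| `^ r) p `^ r^-1)%:E
    <= rect_variation r t0 t1 s0 s1 A)%E.
Proof.
move=> r1 t01 s01 /andP[t0t tt1] sp ps; have r0 : 0 < r by exact: lt_le_trans r1.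
set f := (X in consecutive_sum X p).
have f0 x y : 0 <= f x y by exact: powR_ge0.
(* For [t = t0] the row is degenerate and is no row of any grid, but all its rectangular differences
   vanish. *)
have [tE|t_neq] := eqVneq t t0.
  rewrite /consecutive_sum big1; last first.
    by move=> j _; rewrite /f /rect_diff tE subrr add0r subrr normr0 powR0 ?gt_eqF.
  by rewrite powR0 ?invr_eq0 ?gt_eqF// rect_variation_ge0.
have {t_neq}t0t : t0 < t by rewrite lt_neqAle eq_sym t_neq.
pose w := if t < t1 then [:: t1] else [::].
have part_u : itv_partition t0 t1 (t :: w).
  rewrite /w; split; rewrite /= ?t0t; case: ltP => //=; first by move=> ->.
  by move=> t1t; rewrite eq_le tt1.
have [v part_v pv] := infix_itv_partition _ _ _ s01 sp ps.
apply: (le_trans _ (ereal_sup_ubound _)); last first.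
  by exists (t :: w), v; split.
rewrite lee_fin; apply: ge0_ler_powR.
- by rewrite invr_ge0 ltW.
- by rewrite nnegrE consecutive_sum_ge0.
- by rewrite nnegrE; do 2! apply: sumr_ge0 => ? _; exact: powR_ge0.
apply: (le_trans (consecutive_sum_infix _ _ _ f0 pv)).
(* The index 0 of the outer sum is the row over [[t0, t]]; the other rows are nonnegative. *)
rewrite /= big_ord_recl /= lerDl.
by do 2! apply: sumr_ge0 => ? _; exact: powR_ge0.
Qed.

Lemma variation1_slice_le r t0 t1 s0 s1 A t :
  1 <= r -> t0 < t1 -> s0 < s1 -> t0 <= t <= t1 ->
  (variation1 r `[s0, s1] (fun s => A t s) <=
   rect_variation r t0 t1 s0 s1 A + variation1 r `[s0, s1] (fun s => A t0 s))%E.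
Proof.
move=> r1 t01 s01 tt; have r0 : 0 < r by exact: lt_le_trans r1.
apply: ge_ereal_sup => _ [p [sp ps] <-].
(* Both suprema are bounded below using the same points [p], which leaves an inequality between real
   numbers. *)
apply: (le_trans _ (leeD (row_le_rect_variation r t0 t1 s0 s1 A t p r1 t01 s01 tt sp ps)
  (ereal_sup_ubound _))); last by exists p.
rewrite -EFinD lee_fin.
pose f (j : 'I_(size p).-1) := `|rect_diff A t0 t p`_j p`_j.+1|.
pose g (j : 'I_(size p).-1) := `|A t0 p`_j.+1 - A t0 p`_j|.
have minkowski : (\sum_j (f j + g j) `^ r) `^ r^-1 <=
    (\sum_j f j `^ r) `^ r^-1 + (\sum_j g j `^ r) `^ r^-1.
  by apply: minkowski_powR_sum => // j; exact: normr_ge0.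
apply: le_trans minkowski.
apply: ge0_ler_powR.
- by rewrite invr_ge0 ltW.
- by rewrite nnegrE; apply: sumr_ge0 => ? _; exact: powR_ge0.
- by rewrite nnegrE; apply: sumr_ge0 => ? _; exact: powR_ge0.
apply: ler_sum => j _; apply: ge0_ler_powR.
- exact: ltW.
- by rewrite nnegrE.
- by rewrite nnegrE /f /g addr_ge0.
have -> : A t p`_j.+1 - A t p`_j =
    rect_diff A t0 t p`_j p`_j.+1 + (A t0 p`_j.+1 - A t0 p`_j).
  rewrite /rect_diff [RHS]addrAC.
  by rewrite -(addrA (A t _ - _)) [A t0 _ + (_ - _)]addrC subrK subrK.
exact: ler_normD.
Qed.

(** Transposing a cell interchanges the two corners with a minus sign and fixes the other two, so
    [rect_diff] is unchanged. *)
Lemma rect_variation_swap r t0 t1 s0 s1 A :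
  rect_variation r s0 s1 t0 t1 (fun s t => A t s) = rect_variation r t0 t1 s0 s1 A.
Proof.
rewrite /rect_variation; set S := (X in ereal_sup X = _).
set S' := (X in _ = ereal_sup X); suff -> : S = S' by [].
apply/seteqP; split=> _ [u [v [pu pv ->]]]; exists v, u; split => //;
  rewrite exchange_big/=; congr (_ `^ _)%:E;
  apply: eq_bigr => j _; apply: eq_bigr => k _; congr (`|_| `^ _);
  by rewrite /rect_diff addrAC [RHS]addrAC; congr (_ + _); rewrite addrAC.
Qed.

Lemma variation2_slices r t0 t1 s0 s1 A t s :
  1 <= r -> t0 < t1 -> s0 < s1 -> t0 <= t <= t1 -> s0 <= s <= s1 ->
  (variation1 r `[s0, s1] (fun s' => A t s') <= variation2 r t0 t1 s0 s1 A)%E /\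
  (variation1 r `[t0, t1] (fun t' => A t' s) <= variation2 r t0 t1 s0 s1 A)%E.
Proof.
move=> r1 t01 s01 tt ss; split.
  apply: (le_trans (variation1_slice_le r t0 t1 s0 s1 A t r1 t01 s01 tt)).
  by rewrite /variation2 -addeA leeDl// adde_ge0 ?variation1_ge0.
apply: (le_trans (variation1_slice_le r s0 s1 t0 t1 (fun s t => A t s) s r1 s01 t01 ss)).
rewrite rect_variation_swap /variation2.
(* The nonnegative terms absent from the slice bound are dropped one at a time: first the corner
   value, then the variation of [A t0]. *)
apply: (@le_trans _ _ (rect_variation r t0 t1 s0 s1 A
   + variation1 r `[s0, s1] (fun s => A t0 s)
   + variation1 r `[t0, t1] (fun t => A t s0))%E); last by rewrite leeDl.
by rewrite leeD2r// leeDl// variation1_ge0.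
Qed.

End Slices.

Theorem proposition2p5 (R : realType) (r : R) (hr : 1 <= r) (t s : R)
    (ht : 1 <= t <= 2) (hs : 2 ^- 3 <= s <= 2 ^- 2) :
  (forall A : R -> R -> R,
     (variation1 r `[(2 ^- 3)%R, (2 ^- 2)%R] (fun s' => A t s')
        <= variation2 r 1%R 2%R (2 ^- 3)%R (2 ^- 2)%R A)%E /\
     (variation1 r `[1%R, 2%R] (fun t' => A t' s)
        <= variation2 r 1%R 2%R (2 ^- 3)%R (2 ^- 2)%R A)%E) /\
  (forall A : R -> R -> Rcomplex R,
     (variation1 r `[(2 ^- 3)%R, (2 ^- 2)%R] (fun s' => A t s')
        <= variation2 r 1%R 2%R (2 ^- 3)%R (2 ^- 2)%R A)%E /\
     (variation1 r `[1%R, 2%R] (fun t' => A t' s)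
        <= variation2 r 1%R 2%R (2 ^- 3)%R (2 ^- 2)%R A)%E).
Proof.
have t01 : 1 < 2 :> R by rewrite ltr1n.
have s01 : 2 ^- 3 < 2 ^- 2 :> R by rewrite ltf_pV2 ?posrE ?exprn_gt0// ltr_eXn2l.
by split=> A; exact: variation2_slices.
Qed.
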